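(* Let $A\in\mathcal{S}_L(K_{1,n-1})$ be the weighted Laplacian matrix of the star $K_{1,n-1}$ with edge weights $w_1,\ldots,w_{n-1}>0$. Then $A$ has the SSPWL if and only if the edge weights $w_1,w_2,\ldots,w_{n-1}$ are distinct positive numbers.
   Context: For a finite simple graph $G$ on vertex set $\{1,\ldots,n\}$, $\mathcal{S}_L(G)$ denotes the set of weighted Laplacian matrices of $G$: all $n\times n$ real symmetric matrices $A=[a_{i,j}]$ with, for $i\ne j$, $a_{i,j}<0$ if $\{i,j\}\in E(G)$ and $a_{i,j}=0$ if $\{i,j\}\notin E(G)$, and with $a_{i,i}=-\sum_{k:\{k,i\}\in E(G)}a_{i,k}$ for all $i$. The weight of an edge $\{i,j\}$ is $-a_{i,j}>0$. $K_{1,n-1}$ is the star on $n$ vertices (one center joined to $n-1$ leaves). Let $J$ be the $n\times n$ all-ones matrix and $H=I-\frac1n J$. A matrix $A\in\mathcal{S}_L(G)$ has the strong spectral property for weighted Laplacian matrices (SSPWL) if $X=O$ is the only real symmetric $n\times n$ matrix satisfying $A\circ X=I\circ X=O$ and $H(AX-XA)H=O$, where $\circ$ is the entrywise product. *)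

(* Defs.v *)
From HB Require Import structures.
From mathcomp Require Import all_boot all_order all_algebra.
From mathcomp Require Import reals.

Set Implicit Arguments.
Unset Strict Implicit.
Unset Printing Implicit Defensive.

Import Order.TTheory GRing.Theory Num.Theory.
Local Open Scope ring_scope.

Record sgraph (n : nat) := SGraph {
  adj :> rel 'I_n;
  adj_sym : symmetric adj;
  adj_irr : irreflexive adj
}.

Section Star.
Variables (n : nat) (c : 'I_n).

Definition star_adj : rel 'I_n :=
  fun i j => (i != j) && ((i == c) || (j == c)).

Lemma star_adj_sym : symmetric star_adj.
Proof. by move=> i j; rewrite /star_adj eq_sym orbC. Qed.

Lemma star_adj_irr : irreflexive star_adj.
Proof. by move=> i; rewrite /star_adj eqxx. Qed.

(* K_{1,n-1} with center c; its leaves are lift c j for j : 'I_n.-1. *)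
Definition star : sgraph n := SGraph star_adj_sym star_adj_irr.

End Star.

Section WeightedLaplacian.
Variables (R : realType) (n : nat).
Implicit Types A B X : 'M[R]_n.

Definition weighted_laplacian (G : sgraph n) A : Prop :=
  [/\ A^T = A,
      forall i j, i != j -> G i j -> A i j < 0,
      forall i j, i != j -> ~~ G i j -> A i j = 0
    & forall i, A i i = - \sum_(k | G k i) A i k].

Definition edge_weight A (i j : 'I_n) : R := - A i j.

Definition hadamard A B : 'M[R]_n := map2_mx *%R A B.

Definition centering_mx : 'M[R]_n := 1%:M - n%:R^-1 *: const_mx 1.

Definition SSPWL A : Prop :=
  forall X, X^T = X ->
    hadamard A X = 0 -> hadamard 1%:M X = 0 ->
    centering_mx *m (A *m X - X *m A) *m centering_mx = 0 ->
    X = 0.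

End WeightedLaplacian.

(* Main.v *)
Require Import Defs.
From mathcomp Require Import all_boot all_order all_algebra.
From mathcomp Require Import reals.
From mathcomp Require Import ring lra.

Set Implicit Arguments.
Unset Strict Implicit.
Unset Printing Implicit Defensive.

Import Order.TTheory GRing.Theory Num.Theory.
Local Open Scope ring_scope.

(** Let X be symmetric with A o X = I o X = 0.  Its row and column at the
center vanish, so X is a symmetric matrix Y with zero diagonal on the leaves.
The equation H(AX - XA)H = 0 says that the skew matrix AX - XA has the form
v 1^T - 1 v^T; reading its entries off the star Laplacian, this becomes
[(w_i - w_j) Y_ij = y_i - y_j], where [y = Y w].  So the SSPWL says that Y = 0
is the only solution of this system ([SSPWL_star_leaf_rigid]).

Think of y as the values [y_i = p(w_i)] of a polynomial p.  Whenever
w_i and w_j differ, Y_ij must be the divided difference of p at w_i and w_j.  If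
this formula holds for all i and j distinct, with a value of p' for it when
w_i = w_j, then [y = Y w] says that the polynomial
  [S p = p + X p' - \sum_j w_j (p - p(w_j)) / (X - w_j)]
vanishes at every w_i; the term X p' makes up for the missing diagonal of Y
([horner_leaf_op]).  Division lowers the degree, so S is triangular on the
monomials, with the positive diagonal entries d + 1 ([coef_leaf_op]); hence S is
injective and surjective on the polynomials of bounded degree.

If the weights are distinct, interpolate y by p of degree less than the number m
of leaves: S p has degree less than m and m roots, so S p = 0, p = 0 and Y = 0.

If the weights take only r < m values, one of them, t, is shared by several
leaves.  For two such leaves the system leaves Y_ij free, so the equation S p = 0
at t can be dropped and its defect repaired by adding a constant to these entries.
What remains are r - 1 conditions on the r coefficients of a polynomial of degree
less than r: take S p to be the product of the X - v over the other values v.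
Then p is nonzero and cannot vanish at all r values, so y, and with it Y, is
nonzero. *)

(** * Divided differences and interpolation *)

Section DividedDifferences.
Variable F : fieldType.
Implicit Types (p q : {poly F}) (a b : F).

Definition divdiff p a : {poly F} := (p - p.[a]%:P) %/ ('X - a%:P).

Lemma divdiffK p a : divdiff p a * ('X - a%:P) = p - p.[a]%:P.
Proof. by rewrite divpK // dvdp_XsubCl rootE !hornerE subrr. Qed.

Lemma horner_divdiff p a b :
  b != a -> (divdiff p a).[b] = (p.[b] - p.[a]) / (b - a).
Proof.
move=> nba; have ba0 : b - a != 0 by rewrite subr_eq0.
have /(congr1 (horner^~ b)) := divdiffK p a; rewrite /= !hornerE => <-.
by rewrite mulfK.
Qed.

(** Differentiate [divdiffK] at a. *)
Lemma horner_divdiff_diag p a : (divdiff p a).[a] = p^`().[a].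
Proof.
have /(congr1 (fun q => q^`().[a])) := divdiffK p a.
by rewrite derivM !derivE !hornerE subrr mulr0 add0r subr0.
Qed.

Lemma divdiff_sym p a b : (divdiff p a).[b] = (divdiff p b).[a].
Proof.
have [-> //|nab] := eqVneq a b.
rewrite (horner_divdiff _ nab) horner_divdiff 1?eq_sym //.
by rewrite -[RHS]mulrNN -invrN !opprB.
Qed.

Lemma size_divdiff p a : (size (divdiff p a) <= (size p).-1)%N.
Proof.
rewrite size_divp ?polyXsubC_eq0 // size_XsubC subn1.
have [sp|sp] := leqP (size p) 1.
  by rewrite [p]size1_polyC // hornerC subrr size_poly0.
by rewrite size_polyDl // size_polyN (leq_ltn_trans (size_polyC_leq1 _)).
Qed.

Lemma divdiffD p q a : divdiff (p + q) a = divdiff p a + divdiff q a.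
Proof. by rewrite /divdiff -divpD hornerD polyCD opprD addrACA. Qed.

Lemma interpolation (T : finType) (w : T -> F) (y : T -> F) : injective w ->
  exists2 p : {poly F}, (size p <= #|T|)%N & forall i, p.[w i] = y i.
Proof.
move=> w_inj; pose L i := \prod_(j | j != i) ('X - (w j)%:P).
exists (\sum_i (y i / (L i).[w i]) *: L i).
  apply: (leq_trans (size_sum _ _ _)); apply/bigmax_leqP => i _.
  rewrite (leq_trans (size_scale_leq _ _)) //.
  rewrite /L -big_filter size_prod_XsubC size_filter -sum1_count.
  by rewrite (sum1_card (predC1 i)) cardC1 prednK //; apply/card_gt0P; exists i.
move=> i; rewrite horner_sum (bigD1 i) //= big1 ?addr0 => [|j nji].
  rewrite hornerZ divfK // horner_prod prodf_seq_neq0; apply/allP => j _ /=.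
  by apply/implyP => nji; rewrite !hornerE subr_eq0 inj_eq // eq_sym.
rewrite hornerZ [X in _ * X]horner_prod [X in _ * X](bigD1 i) 1?eq_sym //=.
by rewrite !hornerE subrr /= mulr0 mul0r.
Qed.

End DividedDifferences.

(** * The triangular operator on polynomials *)

Section LeafOperator.
Variables (F : numFieldType) (T : finType) (w : T -> F).
Implicit Types (p q g : {poly F}).

Definition leaf_op p : {poly F} :=
  p + 'X * p^`() - \sum_j w j *: divdiff p (w j).

Lemma leaf_opD p q : leaf_op (p + q) = leaf_op p + leaf_op q.
Proof.
rewrite /leaf_op derivD; under eq_bigr do rewrite divdiffD scalerDr.
by rewrite big_split /=; ring.
Qed.

(** The divided differences have degree less than d, so the top coefficient only
sees [p + 'X * p^`()], and there the Euler operator multiplies it by d. *)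
Lemma coef_leaf_op p d :
  (size p <= d.+1)%N -> (leaf_op p)`_d = d.+1%:R * p`_d.
Proof.
move=> sp; rewrite coefB coefD coefXM coef_sum big1 => [|j _].
  rewrite subr0 -natr1 mulrDl mul1r addrC; congr (_ + _).
  by case: d sp => [|d] sp /=; rewrite ?mul0r // coef_deriv mulr_natl.
rewrite coefZ nth_default ?mulr0 // (leq_trans (size_divdiff _ _)) //.
by rewrite -subn1 leq_subLR.
Qed.

Lemma size_leaf_op p N : (size p <= N)%N -> (size (leaf_op p) <= N)%N.
Proof.
move=> sp; apply/leq_sizeP => d leNd; have spd := leq_trans sp leNd.
by rewrite coef_leaf_op ?nth_default ?mulr0 // (leq_trans spd).
Qed.

Lemma leaf_op_eq0 p : leaf_op p = 0 -> p = 0.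
Proof.
move=> Sp0; apply/eqP; rewrite -size_poly_leq0; apply: contraT.
rewrite -ltnNge => p_gt0; have := @coef_leaf_op p (size p).-1.
rewrite prednK // => /(_ (leqnn _)); rewrite Sp0 coef0 => /esym/eqP.
rewrite mulf_eq0 pnatr_eq0 -lead_coefE lead_coef_eq0 -size_poly_eq0.
by case: (size p) p_gt0.
Qed.

(** Back substitution in a triangular system: a multiple of ['X^N] matches the top
coefficient of g, and the rest has lower degree. *)
Lemma leaf_op_surj N g : (size g <= N)%N ->
  exists2 p : {poly F}, (size p <= N)%N & leaf_op p = g.
Proof.
elim: N g => [|N IHN] g sg.
  exists 0; rewrite ?size_poly0 //; move: sg; rewrite size_poly_leq0 => /eqP ->.
  by apply/eqP; rewrite -size_poly_leq0 size_leaf_op ?size_poly0.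
pose p0 := (g`_N / N.+1%:R) *: 'X^N : {poly F}.
have sp0 : (size p0 <= N.+1)%N.
  by rewrite (leq_trans (size_scale_leq _ _)) ?size_polyXn.
have sgp : (size (g - leaf_op p0)%R <= N)%N.
  apply/leq_sizeP => d; rewrite leq_eqVlt => /predU1P [<-|ltNd].
    rewrite coefB coef_leaf_op // coefZ coefXn eqxx mulr1 mulrC divfK ?subrr //.
    by rewrite pnatr_eq0.
  rewrite coefB !nth_default ?subrr ?(leq_trans sg) //.
  by rewrite (leq_trans (size_leaf_op sp0)).
have [p sp Sp] := IHN _ sgp.
exists (p0 + p); last by rewrite leaf_opD Sp addrC subrK.
by rewrite (leq_trans (size_polyD _ _)) // geq_max sp0 leqW.
Qed.

(** In the full sum over j the diagonal term is [w i * p^`().[w i]], which cancels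
the Euler term of the operator.  A weight [w j] equal to [w i] contributes in the
same way, its divided difference being a value of the derivative. *)
Lemma horner_leaf_op p i :
  \sum_(j | j != i) w j * (divdiff p (w j)).[w i]
    = p.[w i] - (leaf_op p).[w i].
Proof.
rewrite /leaf_op !hornerE horner_sum [in RHS](bigD1 i) //=.
rewrite hornerZ horner_divdiff_diag.
by under [in RHS]eq_bigr do rewrite hornerZ; ring.
Qed.

End LeafOperator.

(** * Rigidity of the leaf system *)

(** The strong spectral property of the star, written on the block of X indexed
by the leaves. *)
Definition leaf_rigid (F : numFieldType) (m : nat) (w : 'I_m -> F) : Prop :=
  forall Y : 'M[F]_m, Y^T = Y -> (forall i, Y i i = 0) ->
    (forall i j, (w i - w j) * Y i j =
       \sum_k w k * Y k i - \sum_k w k * Y k j) ->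
    Y = 0.

Section LeafRigidity.
Variables (F : numFieldType) (m : nat) (w : 'I_m -> F).

(** With p interpolating [Y w], the system makes Y the matrix of divided differences
of p, so that the operator sends p to a polynomial vanishing at all the weights. *)
Lemma leaf_rigid_of_injective : injective w -> leaf_rigid w.
Proof.
move=> w_inj Y Ysym Ydiag EY.
have [p sp py] := interpolation (fun i => \sum_k w k * Y k i) w_inj.
have Ydd i j : j != i -> Y j i = (divdiff p (w j)).[w i].
  move=> nji; rewrite horner_divdiff ?inj_eq 1?eq_sym // !py.
  by rewrite -EY mulrC mulKf ?subr_eq0 ?inj_eq 1?eq_sym // -[in LHS]Ysym mxE.
(* The k = i term of [y_i] drops out because Y has zero diagonal. *)
have Sp_root i : (leaf_op w p).[w i] = 0.
  have := horner_leaf_op w p i; under eq_bigr do rewrite -Ydd //.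
  rewrite py [in X in _ = X - _](bigD1 i) //= Ydiag mulr0 add0r.
  by move/eqP; rewrite -subr_eq0 opprB addrC subrK => /eqP.
have p0 : p = 0.
  apply: (@leaf_op_eq0 _ _ w).
  apply: (@roots_geq_poly_eq0 _ _ [seq w i | i <- enum 'I_m]).
  - by apply/allP => _ /mapP [i _ ->]; rewrite rootE Sp_root.
  - by rewrite map_inj_uniq ?enum_uniq.
  - by rewrite size_map -cardE size_leaf_op.
apply/matrixP => j i; rewrite mxE; have [->//|nji] := eqVneq j i.
by rewrite Ydd // p0 horner_divdiff ?inj_eq 1?eq_sym // !horner0 subrr mul0r.
Qed.

(** Contrapositive: a repeated weight gives a nonzero solution, the divided
differences of p corrected by a constant on the leaves that share this weight. *)
Lemma injective_of_leaf_rigid :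
  (forall i, w i != 0) -> leaf_rigid w -> injective w.
Proof.
move=> w_neq0 rigid a b wab; apply/eqP; apply: contraT => nab.
pose vs := undup [seq w i | i <- enum 'I_m].
have w_vs i : w i \in vs.
  by rewrite mem_undup map_f // mem_enum.
have vs_gt0 : (0 < size vs)%N.
  by rewrite -has_predT; apply/hasP; exists (w a).
(* One root less than the number of distinct weights, which keeps the degree of p
   small enough for p not to vanish at all of them. *)
pose g := \prod_(v <- rem (w a) vs) ('X - v%:P).
have sg : size g = size vs.
  by rewrite size_prod_XsubC size_rem // prednK.
have [p sp Sp] := leaf_op_surj w (eq_leq sg).
have p_neq0 : p != 0.
  apply/eqP => p0.
  have : leaf_op w p == 0.
    by rewrite -size_poly_leq0 size_leaf_op // p0 size_poly0.
  by rewrite Sp -size_poly_leq0 sg leqNgt vs_gt0.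
(* Each leaf of the class C has [#|C| - 1] others in it, all of weight [w a]: z is
   chosen so that together they contribute the missing value [g.[w a]]. *)
pose C := [set k | w k == w a].
pose z := g.[w a] / w a / #|C :\ a|%:R.
pose Y := \matrix_(i, j) if i == j then 0 else
  (divdiff p (w i)).[w j] + z *+ ((i \in C) && (j \in C)).
have Ynd i j : i != j ->
    Y i j = (divdiff p (w i)).[w j] + z *+ ((i \in C) && (j \in C)).
  by move=> /negPf nij; rewrite mxE nij.
have y_p i : \sum_k w k * Y k i = p.[w i].
  rewrite (bigD1 i) //= mxE eqxx mulr0 add0r.
  under eq_bigr do rewrite Ynd // mulrDr.
  rewrite big_split /= horner_leaf_op Sp.
  suff -> : \sum_(k | k != i) w k * (z *+ ((k \in C) && (i \in C))) = g.[w i].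
    by rewrite subrK.
  have [iC|niC] := boolP (i \in C); last first.
    rewrite big1 => [|k _]; last by rewrite andbF mulr0.
    rewrite /g horner_prod (bigD1_seq (w i)) ?rem_uniq ?undup_uniq //=.
      by rewrite !hornerE subrr mul0r.
    by rewrite mem_rem_uniq ?undup_uniq // inE w_vs andbT; move: niC; rewrite inE.
  have wia : w i = w a by move: iC; rewrite inE => /eqP.
  have aC : a \in C by rewrite inE.
  have bC : b \in C by rewrite inE -wab.
  have cardC : #|C :\ i| = #|C :\ a|.
    apply: (@addnI 1); have := cardsD1 i C; rewrite iC => <-.
    by rewrite (cardsD1 a) aC.
  transitivity (\sum_(k in C :\ i) w a * z).
    rewrite [RHS]big_mkcond [LHS]big_mkcond; apply: eq_bigr => k _.
    rewrite !inE; have [//|_] := eqVneq k i; rewrite ?andbT /=.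
    by case: eqP => [->|_]; rewrite ?mulr1n ?mulr0.
  rewrite sumr_const cardC wia /z -mulr_natr; field.
  (* The class has a second leaf, b, so its size minus one is invertible. *)
  rewrite w_neq0 pnatr_eq0 -lt0n; rewrite andbT; apply/card_gt0P. exists b.
  by rewrite !inE eq_sym nab -wab eqxx.
have Y0 : Y = 0.
  apply: rigid => [|i|i j].
  - apply/matrixP => i j; rewrite !mxE eq_sym divdiff_sym andbC.
    by case: eqP.
  - by rewrite mxE eqxx.
  - rewrite !y_p; have [->|nij] := eqVneq i j; first by rewrite !subrr mul0r.
    rewrite Ynd //; have [wij|nwij] := eqVneq (w i) (w j).
      by rewrite wij !subrr mul0r.
    have -> : (i \in C) && (j \in C) = false.
      apply/negP => /andP []; rewrite !inE => /eqP wia /eqP wja.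
      by rewrite wia wja eqxx in nwij.
    rewrite addr0 divdiff_sym horner_divdiff // mulrC divfK // subr_eq0 //.
case/negP: p_neq0; apply/eqP; apply: (@roots_geq_poly_eq0 _ _ vs).
- apply/allP => v; rewrite mem_undup => /mapP [i _ ->].
  by rewrite rootE -y_p Y0 big1 // => k _; rewrite mxE mulr0.
- exact: undup_uniq.
- exact: sp.
Qed.

End LeafRigidity.

(** * From the star to its leaves *)

Section StarReduction.
Variables (R : realType) (n : nat).

(** H is the projection killing the all-ones vector.  So the sandwich vanishes iff
[K i j = f i + g j] for some f and g; skewness forces [g = - f], and f can be
normalised to be column c of K. *)
Lemma centering_sandwich_eq0 (K : 'M[R]_n) c : K^T = - K ->
  centering_mx R n *m K *m centering_mx R n = 0 <->
  forall i j, K i j = K i c - K j c.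
Proof.
move=> Kskew; have Kop i j : K j i = - K i j.
  by have /matrixP/(_ i j) := Kskew; rewrite !mxE.
rewrite /centering_mx; set Q := n%:R^-1 *: const_mx 1.
have QE p (M : 'M[R]_(n, p)) i j : (Q *m M) i j = n%:R^-1 * \sum_k M k j.
  rewrite mxE mulr_sumr; apply: eq_bigr => k _.
  by rewrite !mxE mulr1.
have EQ p (M : 'M[R]_(p, n)) i j : (M *m Q) i j = n%:R^-1 * \sum_k M i k.
  rewrite mxE mulr_sumr; apply: eq_bigr => k _.
  by rewrite !mxE mulr1 mulrC.
split=> [HKH i j|KE].
  (* The entries of [Q *m K] depend on the column only, those of [M *m Q] on the
     row only: this is the splitting of K into g and f. *)
  have KQ : K = Q *m K + (K - Q *m K) *m Q.
    apply/eqP; rewrite -subr_eq0 opprD addrA; apply/eqP.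
    by move: HKH; rewrite mulmxBl mul1mx mulmxBr mulmx1.
  have Kij i' j' :
      K i' j' = n%:R^-1 * (\sum_k K k j') + n%:R^-1 * \sum_k (K - Q *m K) i' k.
    by rewrite -(QE _ K i' j') -(EQ _ (K - Q *m K) i' j') {1}KQ mxE.
  have Kdiag : K j j = 0 by have := Kop j j; lra.
  by move: Kdiag; rewrite !Kij; lra.
pose v := col c K; pose u : 'rV[R]_n := const_mx 1.
have n_neq0 : n%:R != 0 :> R by rewrite pnatr_eq0 -lt0n (leq_trans _ (ltn_ord c)).
have uH : u *m (1%:M - Q) = 0.
  apply/rowP => j; rewrite mulmxBr mulmx1 mxE [X in _ + X]mxE EQ.
  under eq_bigr do rewrite mxE.
  by rewrite sumr_const card_ord mulVf // !mxE subrr.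
have Hu : (1%:M - Q) *m u^T = 0.
  apply/colP => j; rewrite mulmxBl mul1mx mxE [X in _ + X]mxE QE.
  under eq_bigr do rewrite !mxE.
  by rewrite sumr_const card_ord mulVf // !mxE subrr.
have -> : K = v *m u - u^T *m v^T.
  by apply/matrixP => i j; rewrite !mxE !big_ord1 !mxE KE mulr1 mul1r.
move: (1%:M - Q) uH Hu => H uH Hu.
by rewrite mulmxBr mulmxBl -!mulmxA uH !mulmx0 mulmxA Hu mul0mx subrr.
Qed.

Section StarLaplacian.
Variables (c : 'I_n) (A : 'M[R]_n) (w : 'I_n.-1 -> R).
Hypothesis hA : weighted_laplacian (star c) A.
Hypothesis hw : forall a, edge_weight A c (lift c a) = w a.

Lemma star_laplacian_sym i j : A i j = A j i.
Proof. by case: hA => /matrixP/(_ j i); rewrite mxE. Qed.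

Lemma star_laplacian_center a : A c (lift c a) = - w a.
Proof. by rewrite -hw opprK. Qed.

Lemma star_laplacian_leaf a b : A (lift c a) (lift c b) = w a *+ (a == b).
Proof.
have [_ _ A0 Adiag] := hA; have [<-|nab] := eqVneq a b.
  rewrite Adiag (big_pred1 c) => [|k].
    by rewrite star_laplacian_sym star_laplacian_center opprK.
  rewrite /= /star_adj [lift c a == c]eq_sym (negPf (neq_lift c a)) orbF.
  by have [->|_] := eqVneq k c; rewrite ?andbF // neq_lift.
rewrite A0 ?(inj_eq lift_inj) //= /star_adj.
by rewrite ![_ == c]eq_sym !(negPf (neq_lift _ _)) andbF.
Qed.

(** On two leaves the commutator of A and X is [(w a - w b) * X], because the center
does not contribute; its column at the center is [X w]. *)
Lemma star_commutator X : X^T = X -> (forall j, X c j = 0) ->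
  (centering_mx R n *m (A *m X - X *m A) *m centering_mx R n = 0 <->
   forall a b, (w a - w b) * X (lift c a) (lift c b) =
     \sum_k w k * X (lift c k) (lift c a) - \sum_k w k * X (lift c k) (lift c b)).
Proof.
move=> Xsym Xc; have XC i j : X i j = X j i by rewrite -[in LHS]Xsym mxE.
set K := _ - _; have KE i j : K i j = (A *m X) i j - (A *m X) j i.
  rewrite !mxE; congr (_ - _); apply: eq_bigr => k _.
  by rewrite mulrC XC star_laplacian_sym.
have Kskew : K^T = - K by apply/matrixP => i j; rewrite mxE [RHS]mxE !KE opprB.
have Kleaf a b :
    K (lift c a) (lift c b) = (w a - w b) * X (lift c a) (lift c b).
  suff AX a' b' :
      (A *m X) (lift c a') (lift c b') = w a' * X (lift c a') (lift c b').
    by rewrite KE !AX mulrBl [X (lift c b) _]XC.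
  rewrite mxE (bigD1_ord c) //= Xc mulr0 add0r (bigD1 a') //= big1 => [|k nk].
    by rewrite star_laplacian_leaf eqxx addr0.
  by rewrite star_laplacian_leaf eq_sym (negPf nk) mul0r.
have Kcenter a : K (lift c a) c = \sum_k w k * X (lift c k) (lift c a).
  rewrite KE !mxE [X in X - _]big1 => [|k _]; last by rewrite XC Xc mulr0.
  rewrite sub0r (bigD1_ord c) //= Xc mulr0 add0r -sumrN; apply: eq_bigr => k _.
  by rewrite star_laplacian_center mulNr opprK.
have Kcc : K c c = 0 by rewrite KE subrr.
have Kc j : K c j = - K j c by rewrite !KE opprB.
rewrite (centering_sandwich_eq0 c Kskew); split=> [KC a b|E i j].
  by rewrite -Kleaf KC !Kcenter.
case: (unliftP c i) => [a|] ->; last by rewrite Kcc sub0r Kc.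
case: (unliftP c j) => [b|] ->; last by rewrite Kcc subr0.
by rewrite Kleaf E !Kcenter.
Qed.

Lemma SSPWL_star_leaf_rigid :
  (forall a, w a != 0) -> SSPWL A <-> leaf_rigid w.
Proof.
move=> w_neq0; split=> [sspA Y Ysym Ydiag EY|rigid X Xsym AX0 IX0 HKH].
  pose X : 'M[R]_n := \matrix_(i, j)
    if unlift c i is Some a then if unlift c j is Some b then Y a b else 0
    else 0.
  have Xl a b : X (lift c a) (lift c b) = Y a b by rewrite mxE !liftK.
  have Xc j : X c j = 0 by rewrite mxE unlift_none.
  have Xsym : X^T = X.
    apply/matrixP => i j; rewrite !mxE.
    by case: unlift => [a|]; case: unlift => [b|] //; rewrite -[in LHS]Ysym mxE.
  have XC i j : X i j = X j i by rewrite -[in LHS]Xsym mxE.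
  suff X0 : X = 0 by apply/matrixP => a b; rewrite -Xl X0 !mxE.
  apply: sspA => //.
  - apply/matrixP => i j; rewrite mxE [RHS]mxE.
    case: (unliftP c i) => [a|] ->; last by rewrite Xc mulr0.
    case: (unliftP c j) => [b|] ->; last by rewrite XC Xc mulr0.
    rewrite star_laplacian_leaf Xl.
    by have [->|_] := eqVneq a b; rewrite ?Ydiag ?mulr0 ?mul0r.
  - apply/matrixP => i j; rewrite mxE [RHS]mxE [1%:M i j]mxE.
    have [->|_] := eqVneq i j; last by rewrite mul0r.
    by case: (unliftP c j) => [b|] ->; rewrite ?Xc ?Xl ?Ydiag mulr0.
  - apply/(star_commutator Xsym Xc) => a b; rewrite Xl EY.
    by congr (_ - _); apply: eq_bigr => k _; rewrite Xl.
have XC i j : X i j = X j i by rewrite -[in LHS]Xsym mxE.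
have Xdiag i : X i i = 0.
  by move/matrixP: IX0 => /(_ i i); rewrite !mxE eqxx mul1r.
have Xc j : X c j = 0.
  case: (unliftP c j) => [a|] -> //.
  move/matrixP: AX0 => /(_ c (lift c a)); rewrite !mxE star_laplacian_center.
  by move/eqP; rewrite mulf_eq0 oppr_eq0 (negPf (w_neq0 a)) => /eqP.
pose Y := \matrix_(a, b) X (lift c a) (lift c b).
have Y0 : Y = 0.
  apply: rigid => [|a|a b]; rewrite ?mxE //.
    by apply/matrixP => a b; rewrite !mxE.
  have /(star_commutator Xsym Xc) -> := HKH.
  by congr (_ - _); apply: eq_bigr => k _; rewrite mxE.
apply/matrixP => i j; rewrite [RHS]mxE.
case: (unliftP c i) => [a|] -> //.
case: (unliftP c j) => [b|] ->; last by rewrite XC.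
by have /matrixP/(_ a b) := Y0; rewrite !mxE.
Qed.

End StarLaplacian.
End StarReduction.

Theorem theorem4p1 (R : realType) (n : nat) (c : 'I_n) (A : 'M[R]_n)
    (w : 'I_n.-1 -> R)
    (hA : weighted_laplacian (star c) A)
    (hw : forall j : 'I_n.-1, edge_weight A c (lift c j) = w j)
    (hw_gt0 : forall j : 'I_n.-1, 0 < w j) :
  SSPWL A <-> injective w /\ (forall j : 'I_n.-1, 0 < w j).
Proof.
have w_neq0 a : w a != 0 by rewrite gt_eqF.
rewrite (SSPWL_star_leaf_rigid hA hw w_neq0).
split=> [rigid|[w_inj _]]; last exact: leaf_rigid_of_injective.
by split=> //; apply: injective_of_leaf_rigid.
Qed.
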